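(* Let $c_1,c_2>0$ and $b_1,b_2\in\mathbb{R}$ with $b_1>0$, and for every finite subset $\mathfrak{u}\subset\mathbb{N}$ let $$w(\mathfrak{u}) := c_1\,(|\mathfrak{u}|!)^{b_1}\prod_{j\in\mathfrak{u}}\bigl(c_2\, j^{-b_2}\bigr)$$ (so $w(\emptyset)=c_1$). Let $\alpha\ge 1$ with $\alpha\in(b_1,b_2)$, and put $$a:=\frac{b_1}{\alpha},\qquad b:=\frac{b_2}{\alpha},\qquad c:=c_2^{1/\alpha},\qquad z:=\frac{(2/3)^{b-1}}{b-1}.$$ Then for every $s\in\mathbb{N}$ and every $t\in(0,1)$, $$\sum_{\mathfrak{u}\subset\mathbb{N}}[w(\mathfrak{u})]^{1/\alpha}\;\le\; c_1^{1/\alpha}\left(1+\sum_{\ell=1}^{s}(\ell!)^a\,c^\ell\,\frac{z^{\ell-1}}{(\ell-1)!}\left(1+\frac{z}{\ell}\right)+E_{s,t}\right),$$ where the sum on the left is over all finite subsets $\mathfrak{u}$ of $\mathbb{N}$ (including $\emptyset$) and $$E_{s,t}:=c\left(1+\frac{z}{s+1}\right)\left[\frac{t^{s/a}}{1-t^{1/a}}\left(s+\frac{1}{1-t^{1/a}}\right)\right]^{a}\left[\exp\!\left(\Bigl(\frac{cz}{t}\Bigr)^{1/(1-a)}\right)\min\!\left(1,\;\frac{1}{s!}\Bigl(\frac{cz}{t}\Bigr)^{s/(1-a)}\right)\right]^{1-a}.$$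
   Context: $\mathbb{N}=\{1,2,3,\ldots\}$. $|\mathfrak{u}|$ denotes the cardinality of $\mathfrak{u}$; an empty product equals $1$. *)

(* Defs.v *)
From mathcomp Require Export all_boot all_order all_algebra finmap.
From mathcomp Require Export all_classical all_reals.
From mathcomp Require Export sequences esum exp.

Set Implicit Arguments.
Unset Strict Implicit.
Unset Printing Implicit Defensive.

Import Order.TTheory GRing.Theory Num.Theory.

Local Open Scope classical_set_scope.
Local Open Scope fset_scope.
Local Open Scope ring_scope.

(* Finite subsets of {1, 2, 3, ...}, where [nat] starts at 0. *)
Definition finite_subsets_pos : set {fset nat} :=
  [set u : {fset nat} | 0%N \notin u].

Definition weight (R : realType) (c1 c2 b1 b2 : R) (u : {fset nat}) : R :=
  c1 * ((#|` u|)`!%:R `^ b1) * \prod_(j <- u) (c2 * j%:R `^ (- b2)).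

Definition tail_bound (R : realType) (a c z : R) (s : nat) (t : R) : R :=
  c * (1 + z / s.+1%:R)
  * (t `^ (s%:R / a) / (1 - t `^ a^-1)
     * (s%:R + (1 - t `^ a^-1)^-1)) `^ a
  * (expR ((c * z / t) `^ (1 - a)^-1)
     * Num.min 1 (s`!%:R^-1 * (c * z / t) `^ (s%:R / (1 - a)))) `^ (1 - a).

(* Main.v *)
(* With x_j = j^(-b), the l-element sets contribute (l!)^a c^l e_l(x_1, x_2, ...).
   Since x_1 = 1, splitting on whether 1 belongs to the set gives
   e_l = e_(l-1)(x_2, ...) + e_l(x_2, ...) <= z^(l-1)/(l-1)! + z^l/l!, because
   e_l <= (sum x_j)^l / l! and, by convexity of x^(-b), the sum of the x_j over
   j >= 2 is at most the integral of x^(-b) over [3/2, oo[, which is z.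
   For l > s, writing l = k + 1 and c z = t (c z / t), Hoelder's inequality with
   exponents 1/a and 1/(1-a) separates sum (k+1) t^(k/a) from
   sum (c z / t)^(k/(1-a)) / k!, an exponential tail. *)
Require Import Defs.
From mathcomp Require Import ring lra.
From mathcomp Require Import topology ereal normedtype derive realfun.

Set Implicit Arguments.
Unset Strict Implicit.
Unset Printing Implicit Defensive.

Import Order.TTheory GRing.Theory Num.Theory.
Import numFieldNormedType.Exports.

Local Open Scope classical_set_scope.
Local Open Scope ring_scope.

(** * Hoelder's inequality and the two tail series *)

(** [F] and [G] are positive upper bounds rather than the sums themselves: the normalisation divides
    by them, so vanishing sums need no separate case. *)
Lemma hoelder_sum_le (R : realType) (I : Type) (r : seq I) (P : pred I)
    (f g : I -> R) (a F G : R) :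
  0 < a < 1 -> 0 < F -> 0 < G ->
  (forall i, 0 <= f i) -> (forall i, 0 <= g i) ->
  \sum_(i <- r | P i) f i <= F -> \sum_(i <- r | P i) g i <= G ->
  \sum_(i <- r | P i) f i `^ a * g i `^ (1 - a) <= F `^ a * G `^ (1 - a).
Proof.
move=> /andP[a0 a1] F0 G0 f0 g0 fF gG.
have a1' : 0 < 1 - a by lra.
(* Weighted AM-GM applied to f i / F and g i / G. *)
apply: (@le_trans _ _ (\sum_(i <- r | P i)
    F `^ a * G `^ (1 - a) * (a / F * f i + (1 - a) / G * g i))).
  apply: ler_sum => i _.
  have hf : 0 <= f i / F by rewrite divr_ge0// ltW.
  have hg : 0 <= g i / G by rewrite divr_ge0// ltW.
  have := @conjugate_powR _ ((f i / F) `^ a) ((g i / G) `^ (1 - a)) a^-1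
    (1 - a)^-1 (powR_ge0 _ _) (powR_ge0 _ _).
  rewrite !invr_gt0 !invrK => /(_ a0 a1' (subrKC _ _)).
  rewrite -!powRrM !mulfV ?gt_eqF// !powRr1//.
  move=> young; have {1}-> : f i = F * (f i / F) by field; rewrite gt_eqF.
  have {1}-> : g i = G * (g i / G) by field; rewrite gt_eqF.
  rewrite (powRM _ (ltW F0) hf) (powRM _ (ltW G0) hg) mulrACA ler_pM2l
    ?mulr_gt0 ?powR_gt0//.
  by apply: (le_trans young); rewrite le_eqVlt; apply/orP; left; apply/eqP; ring.
rewrite -mulr_sumr big_split/= -!mulr_sumr ler_piMr ?mulr_ge0 ?powR_ge0//.
rewrite -[leRHS](subrK a) addrC; apply: lerD.
  by rewrite mulrAC ler_pdivrMr// ler_wpM2l// ltW.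
by rewrite mulrAC ler_pdivrMr// ler_wpM2l// ltW.
Qed.

Lemma sum_arith_geometric_le (R : realFieldType) (q : R) (s n : nat) :
  0 < q -> q < 1 -> (s <= n)%N ->
  \sum_(s <= k < n) k.+1%:R * q ^+ k <=
    q ^+ s / (1 - q) * (s%:R + (1 - q)^-1).
Proof.
move=> q0 q1 sn.
(* [- B k] is the value of the infinite series of (j+1) q^j over j >= k, so the terms are
   differences of [B]. *)
pose B k := - (q ^+ k / (1 - q) * (k%:R + (1 - q)^-1)).
have q1' : 1 - q != 0 by rewrite subr_eq0 gt_eqF.
rewrite (eq_bigr (fun k => B k.+1 - B k)); last first.
  by move=> k _; rewrite /B exprS -natr1; field.
rewrite telescope_sumr// /B opprK gerDr oppr_le0 mulr_ge0//.
  by rewrite divr_ge0 ?exprn_ge0 ?subr_ge0 ?ltW.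
by rewrite addr_ge0// invr_ge0 subr_ge0 ltW.
Qed.

Lemma sum_exp_coeff_le_expR (R : realType) (y : R) (n : nat) :
  0 <= y -> \sum_(0 <= k < n) y ^+ k / k`!%:R <= expR y.
Proof.
move=> y0; apply: (@nondecreasing_cvgn_le _ (series (exp_coeff y))).
  by apply: nondecreasing_series => k _ _; exact: exp_coeff_ge0.
exact: is_cvg_series_exp_coeff.
Qed.

Lemma fact_mul_le (m n : nat) : (m`! * n`! <= (m + n)`!)%N.
Proof.
rewrite -(@bin_fact (m + n) m) ?leq_addr// addKn leq_pmull// bin_gt0.
exact: leq_addr.
Qed.

(** The 1 in the minimum comes from completing the sum to the whole exponential series, the other
    entry from shifting the index by s and using k! s! <= (k + s)!. *)
Lemma sum_exp_coeff_tail_le (R : realType) (y : R) (s n : nat) :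
  0 <= y -> (s <= n)%N ->
  \sum_(s <= k < n) y ^+ k / k`!%:R <= expR y * Num.min 1 (s`!%:R^-1 * y ^+ s).
Proof.
move=> y0 sn; have t0 k : 0 <= y ^+ k / k`!%:R by rewrite divr_ge0 ?exprn_ge0.
rewrite minr_pMr ?expR_ge0// mulr1 le_min; apply/andP; split.
  apply: le_trans _ (sum_exp_coeff_le_expR n y0).
  by rewrite [leRHS](big_cat_nat (n := s))//= lerDr sumr_ge0.
rewrite -{1}[s]add0n big_addn.
apply: (@le_trans _ _ ((s`!%:R^-1 * y ^+ s) *
    \sum_(0 <= k < n - s) y ^+ k / k`!%:R)).
  rewrite mulr_sumr; apply: ler_sum => k _.
  rewrite [leRHS](_ : _ = (k`! * s`!)%:R^-1 * (y ^+ k * y ^+ s)); last first.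
    by rewrite natrM; field; rewrite !pnatr_eq0 -!lt0n !fact_gt0.
  rewrite [leLHS](_ : _ = ((k + s)`!)%:R^-1 * (y ^+ k * y ^+ s)); last first.
    by rewrite exprD mulrC.
  apply: ler_wpM2r; first by rewrite mulr_ge0 ?exprn_ge0.
  by rewrite lef_pV2 ?posrE ?ltr0n ?muln_gt0 ?fact_gt0// ler_nat fact_mul_le.
by rewrite mulrC ler_wpM2r ?sum_exp_coeff_le_expR//
  mulr_ge0 ?exprn_ge0 ?invr_ge0.
Qed.

(** * Sums of negative powers over integers j >= 2 *)

(** Two AM-GM steps: x y <= h^2 for the midpoint h puts h^(-b) below the geometric mean of x^(-b)
    and y^(-b), hence below their arithmetic mean. *)
Lemma powRN_midpoint_convex (R : realType) (b x y : R) :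
  0 <= b -> 0 < x -> 0 < y ->
  2 * ((x + y) / 2) `^ (- b) <= x `^ (- b) + y `^ (- b).
Proof.
move=> b0 x0 y0.
have [h0 xyh] : 0 < (x + y) / 2 /\ x * y <= (x + y) / 2 * ((x + y) / 2).
  by split; [lra|have := sqr_ge0 (x - y); nra].
move: ((x + y) / 2) h0 xyh => h h0 xyh.
have sq (u : R) : 0 < u -> u `^ (- b) = (u `^ (- b / 2)) ^+ 2.
  by move=> u0; rewrite -powR_mulrn ?powR_ge0// -powRrM; congr (_ `^ _); field.
have le1 : h `^ (- b) <= x `^ (- b / 2) * y `^ (- b / 2).
  rewrite -powRM ?(ltW x0) ?(ltW y0)// sq// expr2 -powRM ?(ltW h0)//.
  rewrite mulNr !powRN lef_pV2 ?posrE ?powR_gt0 ?mulr_gt0//.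
  by rewrite ge0_ler_powR ?nnegrE ?divr_ge0 ?mulr_ge0 ?(ltW x0) ?(ltW y0) ?(ltW h0).
rewrite [x `^ (- b)]sq// [y `^ (- b)]sq//.
move: (x `^ (- b / 2)) (y `^ (- b / 2)) le1 => X Y le1.
have := sqr_ge0 (X - Y); nra.
Qed.

(** Hermite-Hadamard: the right side is the integral of x^(-b) over [m - h, m + h]. In place of
    integration, the mean value theorem is applied to the difference of powers as a function of the
    half-width, and midpoint convexity bounds its derivative from below. *)
Lemma powRN_midpoint_le (R : realType) (b m h : R) :
  1 < b -> 0 < h -> h < m ->
  2 * h * m `^ (- b) <= ((m - h) `^ (1 - b) - (m + h) `^ (1 - b)) / (b - 1).
Proof.
move=> b1 h0 hm.
pose f (x : R) := (m - x) `^ (1 - b) - (m + x) `^ (1 - b).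
pose df (x : R) := (b - 1) * ((m - x) `^ (- b) + (m + x) `^ (- b)).
(* This open interval contains [0, h] and keeps m - x and m + x positive, so [f] is differentiable
   at both endpoints too, which yields continuity on [0, h]. *)
have fdrv (x : R) : x \in `]-h, (h + m) / 2[%R -> is_derive x 1 f (df x).
  rewrite in_itv/= => /andP[x0 xh].
  have mx0 : 0 < m - x by lra.
  have mx0' : 0 < m + x by lra.
  have dm : is_derive x 1 (fun y : R => m - y) (- 1).
    by rewrite -[X in is_derive _ _ _ X]add0r; exact: is_deriveB.
  have dp : is_derive x 1 (fun y : R => m + y) 1.
    by rewrite -[X in is_derive _ _ _ X]add0r; exact: is_deriveD.
  have pm := is_derive1_powR (1 - b) mx0.
  have pp := is_derive1_powR (1 - b) mx0'.
  have := is_deriveB (@is_derive1_comp _ _ (fun y => m - y) _ _ _ pm dm)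
    (@is_derive1_comp _ _ (fun y => m + y) _ _ _ pp dp).
  move=> /is_derive_eq; apply.
  by rewrite /df (_ : 1 - b - 1 = - b); ring.
have fcont : {within `[0, h], continuous f}.
  apply: derivable_within_continuous => x; rewrite in_itv/= => /andP[x0 xh].
  by apply: ex_derive; apply: fdrv; rewrite in_itv/=; apply/andP; split; lra.
have fdrv0 (x : R) : x \in `]0, h[%R -> is_derive x 1 f (df x).
  rewrite in_itv/= => /andP[x0 xh]; apply: fdrv.
  by rewrite in_itv/=; apply/andP; split; lra.
have [x] := @MVT _ f df 0 h h0 fdrv0 fcont.
rewrite in_itv/= => /andP[x0 xh].
have -> : f 0 = 0 by rewrite /f subr0 addr0 subrr.
rewrite !subr0 /f => ->.
have := @powRN_midpoint_convex _ b (m - x) (m + x).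
rewrite (_ : (m - x + (m + x)) / 2 = m); last by field.
have -> : 0 <= b by lra.
have -> : 0 < m - x by lra.
have -> : 0 < m + x by lra.
move=> /(_ isT isT isT) cv.
rewrite /df -[_ * _ * h]mulrA [_ * _ / _]mulrC mulKf ?subr_eq0 ?gt_eqF//.
by rewrite mulrAC ler_pM2r.
Qed.

Lemma sum_nat_powRN_le (R : realType) (b : R) (n : nat) :
  1 < b -> \sum_(2 <= j < n) j%:R `^ (- b) <= (2 / 3) `^ (b - 1) / (b - 1).
Proof.
move=> b1; have b10 : 0 < b - 1 by rewrite subr_gt0.
have [n2|n2] := leqP n 2.
  by rewrite big_geq// divr_ge0 ?powR_ge0// ltW.
(* [F j] is an antiderivative of x^(-b) at j - 1/2; the intervals [j - 1/2, j + 1/2] abut, so the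
   integrals telescope from 3/2. *)
pose F (j : nat) : R := - ((j%:R - 2^-1) `^ (1 - b) / (b - 1)).
apply: (@le_trans _ _ (\sum_(2 <= j < n) (F j.+1 - F j))).
  apply: ler_sum_nat => j /andP[j2 _].
  have j2R : 2 <= j%:R :> R by rewrite ler_nat.
  have := @powRN_midpoint_le _ b j%:R 2^-1 b1 ltac:(lra) ltac:(lra).
  rewrite divff ?pnatr_eq0// mul1r => /le_trans; apply.
  rewrite /F opprK [leRHS]addrC -mulrBl -[j.+1%:R]natr1.
  by rewrite (_ : j%:R + 1 - 2^-1 = j%:R + 2^-1); [|lra].
rewrite telescope_sumr 1?ltnW// /F opprK addrC.
rewrite (_ : 2 - 2^-1 = (2 / 3)^-1); last by field.
rewrite -powR_inv1 ?divr_ge0// -powRrM mulN1r opprB gerDl oppr_le0.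
by rewrite divr_ge0 ?powR_ge0// ltW.
Qed.

Lemma sum_fset_powRN_le (R : realType) (b : R) (D : {fset nat}) :
  1 < b -> {in D, forall j, (2 <= j)%N} ->
  \sum_(j <- D) j%:R `^ (- b) <= (2 / 3) `^ (b - 1) / (b - 1).
Proof.
move=> b1 D2; apply: le_trans _ (sum_nat_powRN_le (\max_(j <- D) j).+1 b1).
rewrite [leRHS](bigID (fun j => j \in D))/= -[leLHS]addr0; apply: lerD.
  rewrite -[leRHS]big_filter le_eqVlt; apply/orP; left; apply/eqP; apply: perm_big.
  apply: uniq_perm; rewrite ?fset_uniq ?filter_uniq ?iota_uniq// => j.
  rewrite mem_filter; apply/idP/andP => [jD|[]//]; split=> //.
  by rewrite mem_index_iota D2//= ltnS (@leq_bigmax_seq _ _ xpredT id).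
by apply: sumr_ge0 => j _; exact: powR_ge0.
Qed.

(** * Elementary symmetric sums over finite sets *)

Lemma big_fpowersetU1 (V : nmodType) (K : choiceType) (x : K) (A : {fset K})
    (F : {fset K} -> V) : x \notin A ->
  \sum_(u <- fpowerset (x |` A)%fset) F u =
    \sum_(u <- fpowerset A) F u + \sum_(u <- fpowerset A) F (x |` u)%fset.
Proof.
move=> xA; rewrite (big_fsetID _ (fun u : {fset K} => x \notin u)); congr (_ + _).
  apply: eq_fbigl => u; rewrite !inE/= !fpowersetE.
  apply/andP/idP => [[uA xu]|uA].
    apply/fsubsetP => y yu; have := fsubsetP uA _ yu.
    by rewrite !inE => /predU1P[yx|//]; rewrite yx (negbTE xu) in yu *.
  split; first exact: fsubset_trans uA (fsubsetUr _ _).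
  by apply: contra xA => /(fsubsetP uA).
transitivity (\sum_(u <- [fset (x |` u)%fset | u in fpowerset A]%fset) F u); last first.
  apply: big_imfset.
  move=> u v; rewrite !fpowersetE => uA vA uv.
  have xu : x \notin u by apply: contra xA => /(fsubsetP uA).
  have xv : x \notin v by apply: contra xA => /(fsubsetP vA).
  by rewrite -(fsetU1K xu) uv fsetU1K.
apply: eq_fbigl => u; rewrite !inE/= negbK; apply/andP/imfsetP => /=.
  rewrite fpowersetE => -[uA xu]; exists (u `\ x)%fset; last by rewrite fsetD1K.
  by rewrite fpowersetE fsubDset.
by move=> [v]; rewrite !fpowersetE => vA ->; rewrite fsetUS// fset1U1.
Qed.

(** These are the first two terms of the binomial expansion in y; they drive the induction in
    [esymf_le]. *)
Lemma bernoulli_expr (R : realFieldType) (S y : R) (l : nat) :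
  0 <= S -> 0 <= y -> S ^+ l.+1 + l.+1%:R * y * S ^+ l <= (y + S) ^+ l.+1.
Proof.
move=> S0 y0; elim: l => [|l IH]; first by rewrite !expr1 expr0; lra.
rewrite [leRHS]exprS.
apply: (@le_trans _ _ ((y + S) * (S ^+ l.+1 + l.+1%:R * y * S ^+ l))).
  (* Exactly the surplus dropped in the induction step. *)
  have P1 : 0 <= y ^+ 2 * S ^+ l * l.+1%:R by rewrite !mulr_ge0 ?exprn_ge0.
  by rewrite !exprS -[l.+2%:R]natr1; nra.
by rewrite ler_wpM2l// addr_ge0.
Qed.

(** The elementary symmetric polynomial of degree l, taken over the power set so that adjoining a
    point to [A] splits the sum. *)
Definition esymf (R : comPzSemiRingType) (K : choiceType) (x : K -> R)
    (A : {fset K}) (l : nat) : R :=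
  \sum_(u <- fpowerset A | #|` u| == l) \prod_(j <- u) x j.

Lemma esymf_fset0 (R : comPzSemiRingType) (K : choiceType) (x : K -> R) l :
  esymf x fset0 l = (l == 0%N)%:R.
Proof.
rewrite /esymf big_mkcond fpowerset0 big_seq_fset1 cardfs0 eq_sym.
by rewrite big_seq_fset0; case: eqP.
Qed.

Lemma esymf0 (R : comPzSemiRingType) (K : choiceType) (x : K -> R) A :
  esymf x A 0 = 1.
Proof.
elim/fset1U_rect: A => [|k A kA IH]; first by rewrite esymf_fset0.
rewrite /esymf big_mkcond big_fpowersetU1// -big_mkcond -[RHS]IH.
rewrite [X in _ + X]big1_fset ?addr0// => u; rewrite fpowersetE => uA _.
by rewrite cardfsU1 (contra (fsubsetP uA k) kA) add1n.
Qed.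

Lemma esymfS (R : comPzSemiRingType) (K : choiceType) (x : K -> R) k A l :
  k \notin A ->
  esymf x (k |` A)%fset l.+1 = esymf x A l.+1 + x k * esymf x A l.
Proof.
move=> kA; rewrite /esymf [LHS]big_mkcond big_fpowersetU1// -big_mkcond; congr (_ + _).
rewrite mulr_sumr [RHS]big_mkcond; apply: eq_fbigr => u; rewrite fpowersetE => uA _.
have ku : k \notin u by apply: contra kA => /(fsubsetP uA).
by rewrite cardfsU1 ku add1n eqSS; case: ifP; rewrite ?mulr0// big_fsetU1.
Qed.

(** Expanding the l-th power yields each squarefree monomial l! times, and all other terms are
    nonnegative. The induction adds one point at a time through [esymfS] instead of using a
    multinomial expansion. *)
Lemma esymf_le (R : realFieldType) (K : choiceType) (x : K -> R) A l :
  (forall j, 0 <= x j) -> esymf x A l <= (\sum_(j <- A) x j) ^+ l / l`!%:R.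
Proof.
move=> x0; elim/fset1U_rect: A l => [l|k A kA IH [|l]].
- by rewrite esymf_fset0 big_seq_fset0 expr0n; case: l => [|l]; rewrite ?divr1// mul0r.
- by rewrite esymf0 expr0 divr1.
rewrite esymfS// big_fsetU1//; set S := \sum_(_ <- _) _.
have S0 : 0 <= S by apply: sumr_ge0.
apply: (@le_trans _ _ (S ^+ l.+1 / l.+1`!%:R + x k * (S ^+ l / l`!%:R))).
  by rewrite lerD// ler_wpM2l.
rewrite ler_pdivlMr ?ltr0n ?fact_gt0//.
apply: le_trans _ (bernoulli_expr l S0 (x0 k)).
rewrite factS natrM le_eqVlt; apply/orP; left; apply/eqP.
by field; rewrite nat1r !pnatr_eq0 -lt0n fact_gt0.
Qed.

Lemma sum_partition_card (V : nmodType) (K : choiceType) (A : {fset K}) (n : nat)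
    (F : {fset K} -> V) : (#|` A| <= n)%N ->
  \sum_(u <- fpowerset A) F u =
    \sum_(0 <= l < n.+1) \sum_(u <- fpowerset A | #|` u| == l) F u.
Proof.
move=> An; under [RHS]eq_bigr do rewrite big_mkcond.
rewrite exchange_big/=; apply: eq_fbigr => u; rewrite fpowersetE => uA _.
under eq_bigr do rewrite eq_sym.
by rewrite -big_mkcond big_nat1_eq /= ltnS (leq_trans (fsubset_leq_card uA) An).
Qed.

(** * Tail estimate and assembly *)

Lemma tail_sum_le (R : realType) (a c z t : R) (s n : nat) :
  0 < a < 1 -> 0 < c -> 0 < z -> 0 < t < 1 -> (s <= n)%N ->
  \sum_(s.+1 <= l < n.+1)
     l`!%:R `^ a * c ^+ l * (z ^+ l.-1 / l.-1`!%:R) * (1 + z / l%:R)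
  <= tail_bound a c z s t.
Proof.
move=> /andP[a0 a1] c0 z0 /andP[t0 t1] sn.
have a1' : 0 < 1 - a by rewrite subr_gt0.
(* Chosen so that (q^k)^a = t^k and (y^k)^(1-a) = x^k, with t x = c z. *)
pose q := t `^ a^-1; pose x := c * z / t; pose y := x `^ (1 - a)^-1.
have x0 : 0 < x by rewrite divr_gt0 ?mulr_gt0.
have q0 : 0 < q by rewrite powR_gt0.
have y0 : 0 < y by rewrite powR_gt0.
have q1 : q < 1.
  have E1 : 1 = 1 `^ a^-1 :> R by rewrite powR1.
  by rewrite [ltRHS]E1 gt0_ltr_powR ?nnegrE ?invr_gt0// ltW.
pose f (k : nat) : R := k.+1%:R * q ^+ k.
pose g (k : nat) : R := y ^+ k / k`!%:R.
(* Since (k+1)! = (k+1) k!, the factor (k+1)!^a / k! equals (k+1)^a (1/k!)^(1-a), which makes each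
   term a Hoelder product. *)
have fgE k : k.+1`!%:R `^ a * ((c * z) ^+ k / k`!%:R) =
    f k `^ a * g k `^ (1 - a).
  have k0 : 0 < k`!%:R :> R by rewrite ltr0n fact_gt0.
  have qk : (q ^+ k) `^ a = t ^+ k.
    rewrite -!powR_mulrn ?(ltW t0) ?(ltW q0)// /q -!powRrM; congr (_ `^ _).
    by field; rewrite gt_eqF.
  have yk : (y ^+ k) `^ (1 - a) = x ^+ k.
    rewrite -!powR_mulrn ?(ltW x0) ?(ltW y0)// /y -!powRrM; congr (_ `^ _).
    by field; rewrite gt_eqF.
  have kk : k`!%:R^-1 `^ (1 - a) = k`!%:R `^ a / k`!%:R.
    rewrite -[in LHS]powR_inv1 ?(ltW k0)// -powRrM mulN1r opprB.
    by rewrite powRB ?(gt_eqF k0) ?implybT// powRr1 ?(ltW k0).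
  have -> : c * z = t * x by rewrite /x mulrCA divff ?mulr1 ?gt_eqF.
  rewrite /f /g factS natrM exprMn !powRM ?exprn_ge0 ?invr_ge0 ?(ltW q0) ?(ltW y0)//.
  by rewrite qk yk kk; ring.
rewrite big_add1 /=.
(* With l = k + 1 and k >= s, the factor 1 + z/l is at most 1 + z/(s+1). *)
apply: (@le_trans _ _ (\sum_(s <= k < n)
    c * (1 + z / s.+1%:R) * (f k `^ a * g k `^ (1 - a)))).
  apply: ler_sum_nat => k /andP[sk _].
  rewrite [leLHS](_ : _ = c * (1 + z / k.+1%:R) *
      (k.+1`!%:R `^ a * ((c * z) ^+ k / k`!%:R))); last first.
    by rewrite exprMn exprS /=; ring.
  rewrite fgE ler_wpM2r ?mulr_ge0 ?powR_ge0// ler_pM2l// lerD2l ler_pM2l//.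
  by rewrite lef_pV2 ?posrE ?ltr0n// ler_nat.
rewrite -mulr_sumr /tail_bound -/x -/y -/q -[leRHS]mulrA ler_wpM2l//.
  by rewrite mulr_ge0 ?addr_ge0 ?divr_ge0 ?(ltW c0) ?(ltW z0).
have -> : t `^ (s%:R / a) = q ^+ s.
  by rewrite /q -powR_mulrn ?powR_ge0// -powRrM mulrC.
have -> : x `^ (s%:R / (1 - a)) = y ^+ s.
  by rewrite /y -powR_mulrn ?powR_ge0// -powRrM mulrC.
have q1' : 0 < 1 - q by rewrite subr_gt0.
apply: hoelder_sum_le; rewrite ?a0//.
- by rewrite mulr_gt0 ?divr_gt0 ?exprn_gt0// ltr_wpDl// invr_gt0.
- by rewrite mulr_gt0 ?expR_gt0// lt_min ltr01/= mulr_gt0 ?exprn_gt0.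
- by move=> k; rewrite mulr_ge0 ?exprn_ge0 ?(ltW q0).
- by move=> k; rewrite divr_ge0 ?exprn_ge0 ?(ltW y0).
- exact: sum_arith_geometric_le.
- by apply: sum_exp_coeff_tail_le => //; exact: ltW.
Qed.

(** [G] sees a set only through its size, so sorting by size leaves elementary symmetric sums. The
    strict bound on the size of [D] makes room for the element 1. *)
Lemma sum_fpowerset_le (R : realType) (G : nat -> R) (b : R) (D : {fset nat})
    (n : nat) :
  let z := (2 / 3) `^ (b - 1) / (b - 1) in
  1 < b -> {in D, forall j, (2 <= j)%N} -> (#|` D| < n)%N ->
  (forall l, 0 <= G l) ->
  \sum_(u <- fpowerset (1%N |` D)%fset)
     G #|` u| * \prod_(j <- u) j%:R `^ (- b) <=
  G 0%N + \sum_(1 <= l < n.+1)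
     G l * (z ^+ l.-1 / l.-1`!%:R) * (1 + z / l%:R).
Proof.
move=> z b1 D2 Dn G0; have D1 : 1%N \notin D by apply/negP => /D2.
pose x (j : nat) : R := j%:R `^ (- b).
have esymf_le_z l : esymf x D l <= z ^+ l / l`!%:R.
  apply: (le_trans (esymf_le _ _ _)) => [j|]; first exact: powR_ge0.
  apply: ler_wpM2r; first by rewrite invr_ge0.
  rewrite lerXn2r ?nnegrE ?sumr_ge0 ?sum_fset_powRN_le// => [j _|].
    exact: powR_ge0.
  by rewrite divr_ge0 ?powR_ge0// subr_ge0 ltW.
rewrite (sum_partition_card (n := n)) ?cardfsU1 ?D1//.
rewrite (eq_bigr (fun l => G l * esymf x (1%N |` D)%fset l)); last first.
  by move=> l _; rewrite /esymf mulr_sumr; apply: eq_bigr => u /eqP->.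
rewrite big_nat_recl// esymf0 mulr1 lerD2l big_add1/=.
apply: ler_sum_nat => l _.
rewrite esymfS// /x powR1 mul1r -mulrA ler_wpM2l//.
(* The index l now stands for size l + 1: z^(l+1)/(l+1)! + z^l/l! = (z^l/l!) (1 + z/(l+1)). *)
apply: (le_trans (lerD (esymf_le_z _) (esymf_le_z _))).
rewrite le_eqVlt; apply/orP; left; apply/eqP.
rewrite factS natrM exprS.
by field; rewrite nat1r !pnatr_eq0 -!lt0n fact_gt0.
Qed.

Theorem corollary1 (R : realType) (c1 c2 b1 b2 alpha : R)
    (hc1 : 0 < c1) (hc2 : 0 < c2) (hb1 : 0 < b1)
    (halpha1 : 1 <= alpha) (hb1alpha : b1 < alpha) (halphab2 : alpha < b2) :
  let a := b1 / alpha in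
  let b := b2 / alpha in
  let c := c2 `^ alpha^-1 in
  let z := (2 / 3) `^ (b - 1) / (b - 1) in
  forall (s : nat) (t : R), (1 <= s)%N -> 0 < t -> t < 1 ->
    (\esum_(u in finite_subsets_pos) (weight c1 c2 b1 b2 u `^ alpha^-1)%:E
     <= (c1 `^ alpha^-1
         * (1 + \sum_(1 <= l < s.+1)
                  l`!%:R `^ a * c ^+ l * (z ^+ l.-1 / l.-1`!%:R)
                  * (1 + z / l%:R)
            + tail_bound a c z s t))%:E)%E.
Proof.
move=> a b c z s t s1 t0 t1.
have alpha0 : 0 < alpha by exact: lt_le_trans halpha1.
have b_gt1 : 1 < b by rewrite ltr_pdivlMr// mul1r.
have a01 : 0 < a < 1 by rewrite divr_gt0// ltr_pdivrMr// mul1r.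
have c0 : 0 < c by rewrite powR_gt0.
have z0 : 0 < z by rewrite divr_gt0 ?powR_gt0 ?divr_gt0 ?subr_gt0.
pose G (l : nat) : R := l`!%:R `^ a * c ^+ l.
have G0 l : 0 <= G l by rewrite mulr_ge0 ?powR_ge0// exprn_ge0 ?powR_ge0.
have weightE (u : {fset nat}) : weight c1 c2 b1 b2 u `^ alpha^-1 =
    c1 `^ alpha^-1 * (G #|` u| * \prod_(j <- u) j%:R `^ (- b)).
  have prodE (v : seq nat) :
      (\prod_(j <- v) (c2 * j%:R `^ (- b2))) `^ alpha^-1 =
      c ^+ size v * \prod_(j <- v) j%:R `^ (- b).
    elim: v => [|j v IH]; first by rewrite !big_nil powR1 mulr1.
    rewrite !big_cons powRM ?IH ?mulr_ge0 ?powR_ge0 ?(ltW hc2)//; last first.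
      by rewrite prodr_ge0// => i _; rewrite mulr_ge0 ?powR_ge0 ?(ltW hc2).
    rewrite powRM ?powR_ge0 ?(ltW hc2)// -powRrM mulNr -/b -/c exprS /=.
    ring.
  rewrite /weight powRM ?mulr_ge0 ?powR_ge0 ?(ltW hc1)//; last first.
    by rewrite prodr_ge0// => i _; rewrite mulr_ge0 ?powR_ge0 ?(ltW hc2).
  by rewrite powRM ?powR_ge0 ?(ltW hc1)// -powRrM -/a prodE /G !mulrA.
(* The infinite sum is a supremum over finite families [X], so a bound uniform in [X] suffices. *)
apply: ge_ereal_sup => _ [X [finX XS] <-].
rewrite fsbig_finite// sumEFin lee_fin.
under eq_bigr do rewrite weightE.
rewrite -mulr_sumr ler_wpM2l ?powR_ge0//.
(* All elements other than 1 of members of [X]; the members avoid 0, so these are at least 2. *)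
pose D := ((\bigcup_(u <- fset_set X) u) `\ 1%N)%fset.
have D2 : {in D, forall j, (2 <= j)%N}.
  move=> [|[|j]]//; rewrite !inE//= => /bigfcupP[u /andP[]].
  by rewrite in_fset_set// inE => /XS /negP.
have XD : (fset_set X `<=` fpowerset (1%N |` D))%fset.
  apply/fsubsetP => u uX; rewrite fpowersetE; apply/fsubsetP => j ju.
  rewrite !inE; case: eqVneq => //= _; apply/bigfcupP; exists u => //.
  by rewrite uX.
(* Large enough to exceed the size of [D] and to reach [s], where the sum over sizes is cut. *)
pose n := (s + #|` D|.+1)%N.
(* The terms are nonnegative, so [X] may be enlarged to a full power set. *)
apply: (@le_trans _ _ (\sum_(u <- fpowerset (1%N |` D)%fset)
     G #|` u| * \prod_(j <- u) j%:R `^ (- b))).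
  have F0 (u : {fset nat}) : 0 <= G #|` u| * \prod_(j <- u) j%:R `^ (- b).
    by rewrite mulr_ge0// prodr_ge0// => j _; exact: powR_ge0.
  rewrite [leRHS](big_fsetID _ (fun u => u \in fset_set X))/=.
  rewrite -[leLHS]addr0 lerD ?sumr_ge0// le_eqVlt; apply/orP; left; apply/eqP.
  apply: eq_fbigl => u; rewrite !inE/=; apply/idP/andP => [uX|[]//].
  by split=> //; exact: (fsubsetP XD).
have Dn : (#|` D| < n)%N by rewrite /n leq_addl.
apply: (le_trans (sum_fpowerset_le b_gt1 D2 Dn G0)).
rewrite {1}/G fact0 powR1 mulr1 -addrA lerD2l.
(* Sizes 1 to s give the main sum verbatim; the larger sizes form the tail. *)
rewrite (big_cat_nat (n := s.+1)) ?ltnS ?leq_addr//= lerD2l.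
by apply: tail_sum_le => //; [rewrite t0 t1|exact: leq_addr].
Qed.
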